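(* Let $I,J,K$ be finite groupoids with parity structure, and let $\widehat X=(I\xleftarrow{p_X} X\xrightarrow{q_X} J,\rho)$ and $\widehat Y=(J\xleftarrow{p_Y} Y\xrightarrow{q_Y} K,\rho')$ be composable $\mathbb P$-spans, with composite $\mathbb P$-span having apex the homotopy pullback $X\times_J Y$. Then for all $i\in I$ and $k\in K$ there is a canonical equivalence of scalars $$ {}_i(X\times_J Y)_k \;\simeq\; \int_{j\in J} \big( {}_i X_j \times {}_j Y_k\big). $$
   Context: Let $O(1)=\{+1,-1\}$ and let $\mathbb P=BO(1)$ be the one-object groupoid with automorphism group $O(1)$. All groupoids are finite (finitely many isomorphism classes, finite hom sets), and all pullbacks, fibres, quotients and colimits are the homotopy (weak) ones. Composites of arrows are written in diagrammatic order. A parity structure on a groupoid $S$ is a functor $S\to\mathbb P$; it assigns to each arrow $a$ a parity $\mathrm{par}(a)\in\{\pm1\}$ (even $=+1$, odd $=-1$), multiplicatively. $\mathsf e:1\to\mathbb P$ is the unique parity structure on the terminal groupoid. A $\mathbb P$-span from $f:S\to\mathbb P$ to $g:T\to\mathbb P$ is a span of groupoids $S\xleftarrow{p}M\xrightarrow{q}T$ together with a natural isomorphism $\rho:f p\Rightarrow g q$, i.e. signs $\rho_x\in\{\pm1\}$ for $x\in M$ with $\mathrm{par}(p(a))\,\rho_{x'}=\rho_x\,\mathrm{par}(q(a))$ for each $a:x\to x'$ in $M$. A morphism of $\mathbb P$-spans $(M,p,q,\rho)\to(N,p',q',\delta)$ is a functor $u:M\to N$ with natural isomorphisms $\sigma:p\Rightarrow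 p'u$, $\tau:q\Rightarrow q'u$ such that $\rho_x\,\mathrm{par}(\tau_x)=\mathrm{par}(\sigma_x)\,\delta_{u(x)}$ for all $x$; it is an equivalence if $u$ is an equivalence of groupoids. Composition of $\mathbb P$-spans is by homotopy pullback: the objects of $X\times_JY$ are triples $(x,a:q_X(x)\to p_Y(y),y)$, and the $2$-cell of the composite has component $\rho_x\cdot\mathrm{par}(a)\cdot\rho'_y$. A scalar is a $\mathbb P$-span from $\mathsf e$ to $\mathsf e$; morphisms and equivalences of scalars are those of $\mathbb P$-spans. Thus a scalar is a groupoid with a locally constant sign function, and an equivalence of scalars is a sign-preserving equivalence of groupoids. For a $\mathbb P$-span $I\xleftarrow{p}M\xrightarrow{q}J$ with $2$-cell $\rho$, the two-sided fibre ${}_iM_j$ is the scalar whose objects are $(m,\;a:i\to p(m),\;b:q(m)\to j)$ with sign $\mathrm{par}(a)\cdot\rho_m\cdot\mathrm{par}(b)$. The product of scalars is the product groupoid with signs multiplied. The homotopy sum $\int_{j\in J}F(j)$ denotes the (homotopy) colimit over the groupoid $J$, here in the category of scalars; it splits as $\sum_{j\in\pi_0J}F(j)/\mathrm{Aut}(j)$ (weak quotients). Here $\mathrm{Aut}(j)$ acts diagonally on ${}_iX_j\times{}_jY_k$, $g$ acting by postcomposition with $g$ on $b:q_X(x)\to j$ and by precomposition with $g^{-1}$ on $j\to p_Y(y)$. *)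

(* Defs.v *)
From mathcomp Require Import all_boot.

Set Implicit Arguments.
Unset Strict Implicit.
Unset Printing Implicit Defensive.

#[local] Obligation Tactic := idtac.

Declare Scope groupoid_scope.
Delimit Scope groupoid_scope with gpd.
Local Open Scope groupoid_scope.

(** * Finite groupoids *)

(* Finite means: finite hom sets and finitely many isomorphism classes; the
   type of objects itself may be infinite. Composition [cmp] is written in
   diagrammatic order. *)
Record groupoid := Groupoid {
  ob :> Type;
  hom : ob -> ob -> finType;
  idg : forall x, hom x x;
  cmp : forall x y z, hom x y -> hom y z -> hom x z;
  inv : forall x y, hom x y -> hom y x;
  cmp1g : forall x y (a : hom x y), cmp (idg x) a = a;
  cmpg1 : forall x y (a : hom x y), cmp a (idg y) = a;
  cmpA : forall x y z w (a : hom x y) (b : hom y z) (c : hom z w),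
    cmp a (cmp b c) = cmp (cmp a b) c;
  cmpgV : forall x y (a : hom x y), cmp a (inv a) = idg x;
  cmpVg : forall x y (a : hom x y), cmp (inv a) a = idg y;
  pi0_finite : exists (T : finType) (r : T -> ob),
    forall x, exists t, inhabited (hom x (r t))
}.
Arguments idg {_} x.
Notation "a ;; b" := (cmp a b)
  (at level 45, left associativity) : groupoid_scope.

Record functor (A B : groupoid) := Functor {
  fob :> A -> B;
  fmap : forall x y : A, hom x y -> hom (fob x) (fob y);
  fmap1 : forall x, fmap (idg x) = idg (fob x);
  fmapM : forall x y z (a : hom x y) (b : hom y z),
    fmap (a ;; b) = fmap a ;; fmap b
}.
Arguments fmap {A B} f {x y} a.

Program Definition fid (A : groupoid) : functor A A :=
  @Functor A A id (fun _ _ a => a) _ _.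
Next Obligation. by []. Qed.
Next Obligation. by []. Qed.

Program Definition fcomp (A B C : groupoid) (F : functor A B)
    (G : functor B C) : functor A C :=
  @Functor A C (fun x => G (F x)) (fun _ _ a => fmap G (fmap F a)) _ _.
Next Obligation. by move=> A B C F G x; rewrite /= !fmap1. Qed.
Next Obligation. by move=> A B C F G x y z a b; rewrite /= !fmapM. Qed.

(* Invertibility of the components is automatic. *)
Record natiso (A B : groupoid) (F G : functor A B) := NatIso {
  ncomp :> forall x, hom (F x) (G x);
  nnat : forall x y (a : hom x y), fmap F a ;; ncomp y = ncomp x ;; fmap G a
}.

Definition is_gequiv (A B : groupoid) (F : functor A B) : Prop :=
  exists G : functor B A,
    inhabited (natiso (fcomp F G) (fid A)) /\
    inhabited (natiso (fcomp G F) (fid B)).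

Section GroupoidTheory.
Variable A : groupoid.
Implicit Types x y z : A.

Lemma cmpKg x y z (a : hom x y) (b : hom x z) : a ;; (inv a ;; b) = b.
Proof. by rewrite cmpA cmpgV cmp1g. Qed.

Lemma cmpKVg x y z (a : hom y x) (b : hom x z) : inv a ;; (a ;; b) = b.
Proof. by rewrite cmpA cmpVg cmp1g. Qed.

Lemma cmpgK x y z (a : hom x y) (b : hom z x) : b ;; a ;; inv a = b.
Proof. by rewrite -cmpA cmpgV cmpg1. Qed.

Lemma cmpgKV x y z (a : hom y x) (b : hom z x) : b ;; inv a ;; a = b.
Proof. by rewrite -cmpA cmpVg cmpg1. Qed.

Lemma cmpgI x y z (a : hom x y) (b c : hom y z) : a ;; b = a ;; c -> b = c.
Proof. by move=> e; rewrite -(cmpKVg a b) e cmpKVg. Qed.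

Lemma cmpIg x y z (a b : hom x y) (c : hom y z) : a ;; c = b ;; c -> a = b.
Proof. by move=> e; rewrite -(cmpgK c a) e cmpgK. Qed.

Lemma invM x y z (a : hom x y) (b : hom y z) :
  inv (a ;; b) = inv b ;; inv a.
Proof. by apply: (@cmpgI _ _ _ (a ;; b)); rewrite cmpgV cmpA cmpgK cmpgV. Qed.

Lemma inv1 x : inv (idg x) = idg x.
Proof. by rewrite -[LHS]cmp1g cmpgV. Qed.

End GroupoidTheory.

Lemma fmapV (A B : groupoid) (F : functor A B) (x y : A) (a : hom x y) :
  fmap F (inv a) = inv (fmap F a).
Proof. by apply: (@cmpgI _ _ _ _ (fmap F a)); rewrite -fmapM !cmpgV fmap1. Qed.

Program Definition gone : groupoid :=
  @Groupoid unit (fun _ _ => unit) (fun _ => tt) (fun _ _ _ _ _ => tt)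
    (fun _ _ _ => tt) _ _ _ _ _ _.
Next Obligation. by move=> ? ? []. Qed.
Next Obligation. by move=> ? ? []. Qed.
Next Obligation. by []. Qed.
Next Obligation. by []. Qed.
Next Obligation. by []. Qed.
Next Obligation. by exists unit, id => x; exists tt. Qed.

Program Definition gprod (A B : groupoid) : groupoid :=
  @Groupoid (A * B)%type (fun z w => (hom z.1 w.1 * hom z.2 w.2)%type)
    (fun z => (idg z.1, idg z.2))
    (fun _ _ _ a b => (a.1 ;; b.1, a.2 ;; b.2))
    (fun _ _ a => (inv a.1, inv a.2)) _ _ _ _ _ _.
Next Obligation. by move=> A B x y [a b]; rewrite /= !cmp1g. Qed.
Next Obligation. by move=> A B x y [a b]; rewrite /= !cmpg1. Qed.
Next Obligation. by move=> A B x y z w a b c; rewrite /= !cmpA. Qed.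
Next Obligation. by move=> A B x y a; rewrite /= !cmpgV. Qed.
Next Obligation. by move=> A B x y a; rewrite /= !cmpVg. Qed.
Next Obligation.
move=> A B; have [S [r rP]] := pi0_finite A; have [T [s sP]] := pi0_finite B.
exists (S * T)%type, (fun z => (r z.1, s z.2)) => -[x y].
have [[t [a]] [u [b]]] := (rP x, sP y).
by exists (t, u); split; exact: (a, b).
Qed.

(** * Parity *)

(* A sign is a Boolean: [false] stands for +1 (even), [true] for -1 (odd), and
   [addb] is the multiplication of signs. *)
Definition O1 : finType := bool.

Program Definition BO1 : groupoid :=
  @Groupoid unit (fun _ _ => O1) (fun _ => false) (fun _ _ _ => addb)
    (fun _ _ => id) _ _ _ _ _ _.
Next Obligation. by []. Qed.
Next Obligation. by move=> ? ? a; rewrite /= addbF. Qed.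
Next Obligation. by move=> ? ? ? ? a b c; rewrite /= addbA. Qed.
Next Obligation. by move=> ? ? a; rewrite /= addbb. Qed.
Next Obligation. by move=> ? ? a; rewrite /= addbb. Qed.
Next Obligation. by exists unit, id => x; exists tt; split; exact: false. Qed.

Record pgroupoid := PGroupoid {
  pcarrier :> groupoid;
  parity : functor pcarrier BO1
}.

Definition par (S : pgroupoid) (x y : S) (a : hom x y) : O1 :=
  fmap (parity S) a.

Program Definition parity_one : functor gone BO1 :=
  @Functor gone BO1 id (fun _ _ _ => false) _ _.
Next Obligation. by []. Qed.
Next Obligation. by []. Qed.

Definition pone : pgroupoid := PGroupoid parity_one.

(** * Spans of groupoids with parity *)

Record pspan (S T : pgroupoid) := PSpan {
  apex :> groupoid;
  legl : functor apex S;
  legr : functor apex T;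
  cell : natiso (fcomp legl (parity S)) (fcomp legr (parity T))
}.

Definition psign (S T : pgroupoid) (M : pspan S T) (x : M) : O1 := cell M x.

Record psmor (S T : pgroupoid) (M N : pspan S T) := PSMor {
  psfun :> functor M N;
  pssigma : natiso (legl M) (fcomp psfun (legl N));
  pstau : natiso (legr M) (fcomp psfun (legr N));
  pscompat : forall x : M,
    psign x (+) par (pstau x) = par (pssigma x) (+) psign (psfun x)
}.

(* Only the underlying functor matters: a quasi-inverse of it inherits 2-cells
   compatible with the signs. *)
Definition is_psequiv (S T : pgroupoid) (M N : pspan S T) (u : psmor M N) :
  Prop := is_gequiv u.

Record pscell (S T : pgroupoid) (M N : pspan S T) (u v : psmor M N) := PSCell {
  pscnat :> natiso u v;
  pscell_l : forall x, pssigma u x ;; fmap (legl N) (pscnat x) = pssigma v x;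
  pscell_r : forall x, pstau u x ;; fmap (legr N) (pscnat x) = pstau v x
}.

Program Definition psid (S T : pgroupoid) (M : pspan S T) : psmor M M :=
  @PSMor S T M M (fid M) (NatIso (ncomp := fun x => idg _) _)
    (NatIso (ncomp := fun x => idg _) _) _.
Next Obligation. by move=> S T M x y a; rewrite /= cmp1g cmpg1. Qed.
Next Obligation. by move=> S T M x y a; rewrite /= cmp1g cmpg1. Qed.
Next Obligation. by move=> S T M x; rewrite /par !fmap1 /= addbF. Qed.

Program Definition psmcomp (S T : pgroupoid) (M N P : pspan S T)
    (u : psmor M N) (v : psmor N P) : psmor M P :=
  @PSMor S T M P (fcomp u v)
    (NatIso (ncomp := fun x => pssigma u x ;; pssigma v (u x)) _)
    (NatIso (ncomp := fun x => pstau u x ;; pstau v (u x)) _) _.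
Next Obligation.
move=> S T M N P u v x y a; rewrite /= cmpA (nnat (pssigma u) a).
by rewrite -!cmpA (nnat (pssigma v) (fmap u a)).
Qed.
Next Obligation.
move=> S T M N P u v x y a; rewrite /= cmpA (nnat (pstau u) a).
by rewrite -!cmpA (nnat (pstau v) (fmap u a)).
Qed.
Next Obligation.
move=> S T M N P u v x; rewrite /par !fmapM /= addbA.
have /= := pscompat u x; rewrite /par => ->.
by rewrite -!addbA; have /= := pscompat v (u x); rewrite /par => ->.
Qed.

Section HomotopyPullback.
Variables (A B C : groupoid) (F : functor A C) (G : functor B C).

Record pb_ob := PbOb {
  pb_fst : A;
  pb_snd : B;
  pb_arr : hom (F pb_fst) (G pb_snd)
}.

Definition pb_hom (z w : pb_ob) : finType :=
  {a : hom (pb_fst z) (pb_fst w) * hom (pb_snd z) (pb_snd w)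
     | fmap F a.1 ;; pb_arr w == pb_arr z ;; fmap G a.2}.

Program Definition pullback : groupoid :=
  @Groupoid pb_ob pb_hom
    (fun z => Sub (idg (pb_fst z), idg (pb_snd z)) _)
    (fun x y z a b => Sub ((val a).1 ;; (val b).1, (val a).2 ;; (val b).2) _)
    (fun x y a => Sub (inv (val a).1, inv (val a).2) _) _ _ _ _ _ _.
Next Obligation. by move=> z; rewrite /= !fmap1 cmp1g cmpg1. Qed.
Next Obligation.
move=> x y z [a /= /eqP Ha] [b /= /eqP Hb].
by rewrite !fmapM -cmpA Hb cmpA Ha cmpA.
Qed.
Next Obligation.
move=> x y [a /= /eqP Ha]; rewrite !fmapV; apply/eqP.
by apply: (@cmpgI _ _ _ _ (fmap F a.1)); rewrite cmpKg cmpA Ha cmpgK.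
Qed.
Next Obligation.
by move=> x y a; apply: val_inj; case: a => [[a b] H]; rewrite /= !cmp1g.
Qed.
Next Obligation.
by move=> x y a; apply: val_inj; case: a => [[a b] H]; rewrite /= !cmpg1.
Qed.
Next Obligation. by move=> x y z w a b c; apply: val_inj; rewrite /= !cmpA. Qed.
Next Obligation. by move=> x y a; apply: val_inj; rewrite /= !cmpgV. Qed.
Next Obligation. by move=> x y a; apply: val_inj; rewrite /= !cmpVg. Qed.
Next Obligation.
have [S [r rP]] := pi0_finite A; have [T [s sP]] := pi0_finite B.
exists {t : S * T & hom (F (r t.1)) (G (s t.2))}, (fun t => PbOb (tagged t)).
case=> x y c; have [[t [a]] [u [b]]] := (rP x, sP y).
pose c' : hom (F (r (t, u).1)) (G (s (t, u).2)) :=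
  inv (fmap F a) ;; c ;; fmap G b.
exists (Tagged (fun t => hom (F (r t.1)) (G (s t.2))) c'); split.
by exists (a, b); rewrite /= /c' !cmpA cmpgV cmp1g.
Qed.

Program Definition pb_pr1 : functor pullback A :=
  @Functor pullback A pb_fst (fun _ _ a => (val a).1) _ _.
Next Obligation. by []. Qed.
Next Obligation. by []. Qed.

Program Definition pb_pr2 : functor pullback B :=
  @Functor pullback B pb_snd (fun _ _ a => (val a).2) _ _.
Next Obligation. by []. Qed.
Next Obligation. by []. Qed.

End HomotopyPullback.

Program Definition pscomp (S T U : pgroupoid) (X : pspan S T)
    (Y : pspan T U) : pspan S U :=
  @PSpan S U (pullback (legr X) (legl Y))
    (fcomp (pb_pr1 _ _) (legl X)) (fcomp (pb_pr2 _ _) (legr Y))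
    (NatIso (ncomp := fun z =>
       psign (pb_fst z) (+) par (pb_arr z) (+) psign (pb_snd z)) _).
Next Obligation.
move=> S T U X Y z w a /=.
have /= Hx := nnat (cell X) (val a).1; have /= Hy := nnat (cell Y) (val a).2.
have /eqP/(congr1 (@par T _ _)) := valP a; rewrite /par !fmapM /= => Ha.
rewrite /psign /par !addbA Hx -(addbA (cell X _)) Ha.
by rewrite -!addbA Hy.
Qed.

(** * Scalars *)

(* The legs and the 2-cell of a scalar amount to a locally constant sign on the
   apex, and 1-morphisms (2-cells) to sign-preserving functors (natural
   isomorphisms): see [mk_scalar], [mk_smor], [mk_scell] and [psmor_sign]. *)
Definition scalar := pspan pone pone.

Lemma psign_const (M : scalar) (x y : M) : hom x y -> psign x = psign y.
Proof.
by rewrite /psign => a; have /= := nnat (cell M) a; rewrite addbF => ->.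
Qed.

Lemma unit_hom (x y : gone) (a b : hom x y) : a = b.
Proof. by case: a b => [] []. Qed.

Program Definition to_one (M : groupoid) : functor M gone :=
  @Functor M gone (fun _ => tt) (fun _ _ _ => tt) _ _.
Next Obligation. by []. Qed.
Next Obligation. by []. Qed.

Program Definition mk_scalar (M : groupoid) (s : M -> O1)
    (sP : forall x y : M, hom x y -> s x = s y) : scalar :=
  @PSpan pone pone M (to_one M) (to_one M) (NatIso (ncomp := s) _).
Next Obligation. by move=> M s sP x y a /=; rewrite addbF (sP x y a). Qed.

Program Definition mk_smor (M N : scalar) (u : functor M N)
    (uP : forall x, psign x = psign (u x)) : psmor M N :=
  @PSMor pone pone M N u (NatIso (ncomp := fun _ => tt) _)
    (NatIso (ncomp := fun _ => tt) _) _.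
Next Obligation. by []. Qed.
Next Obligation. by []. Qed.
Next Obligation. by move=> M N u uP x /=; rewrite addbF. Qed.

Definition mk_scell (M N : scalar) (u v : psmor M N) (t : natiso u v) :
  pscell u v :=
  PSCell (pscnat := t) (fun _ => unit_hom _ _) (fun _ => unit_hom _ _).

Lemma psmor_sign (M N : scalar) (u : psmor M N) x : psign x = psign (u x).
Proof. by have /= := pscompat u x; rewrite /par /= addbF. Qed.

Program Definition sprod (M N : scalar) : scalar :=
  @mk_scalar (gprod M N) (fun z => psign z.1 (+) psign z.2) _.
Next Obligation.
by move=> M N x y [a b] /=; rewrite (psign_const a) (psign_const b).
Qed.

Section TwoSidedFibre.
Variables (S T : pgroupoid) (M : pspan S T) (i : S) (j : T).

Record fib_ob := FibOb {
  fib_pt : M;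
  fib_src : hom i (legl M fib_pt);
  fib_tgt : hom (legr M fib_pt) j
}.

Definition fib_hom (z w : fib_ob) : finType :=
  {u : hom (fib_pt z) (fib_pt w)
     | (fib_src z ;; fmap (legl M) u == fib_src w) &&
       (fmap (legr M) u ;; fib_tgt w == fib_tgt z)}.

Program Definition fib_gpd : groupoid :=
  @Groupoid fib_ob fib_hom
    (fun z => Sub (idg (fib_pt z)) _)
    (fun x y z a b => Sub (val a ;; val b) _)
    (fun x y a => Sub (inv (val a)) _) _ _ _ _ _ _.
Next Obligation. by move=> z; rewrite /= !fmap1 cmp1g cmpg1 !eqxx. Qed.
Next Obligation.
move=> x y z [a /= /andP[/eqP Ha /eqP Ha']] [b /= /andP[/eqP Hb /eqP Hb']].
by rewrite !fmapM cmpA Ha Hb -cmpA Hb' Ha' !eqxx.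
Qed.
Next Obligation.
move=> x y [a /= /andP[/eqP Ha /eqP Ha']].
by rewrite !fmapV -Ha -Ha' cmpgK cmpKVg !eqxx.
Qed.
Next Obligation. by move=> x y a; apply: val_inj; rewrite /= cmp1g. Qed.
Next Obligation. by move=> x y a; apply: val_inj; rewrite /= cmpg1. Qed.
Next Obligation. by move=> x y z w a b c; apply: val_inj; rewrite /= cmpA. Qed.
Next Obligation. by move=> x y a; apply: val_inj; rewrite /= cmpgV. Qed.
Next Obligation. by move=> x y a; apply: val_inj; rewrite /= cmpVg. Qed.
Next Obligation.
have [R [r rP]] := pi0_finite M.
exists {t : R & (hom i (legl M (r t)) * hom (legr M (r t)) j)%type},
  (fun t => FibOb (tagged t).1 (tagged t).2).
case=> m a b; have [t [c]] := rP m.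
exists (Tagged (fun t => (hom i (legl M (r t)) * hom (legr M (r t)) j)%type)
  (a ;; fmap (legl M) c, inv (fmap (legr M) c) ;; b)); split.
by exists c; rewrite /= cmpKg !eqxx.
Qed.

Program Definition fibre : scalar :=
  @mk_scalar fib_gpd
    (fun z => par (fib_src z) (+) psign (fib_pt z) (+) par (fib_tgt z)) _.
Next Obligation.
move=> z w [a /= /andP[/eqP Ha /eqP Ha']].
rewrite -Ha -Ha' /par !fmapM /= -!addbA; congr addb; rewrite !addbA.
by have /= := nnat (cell M) a; rewrite /psign => ->.
Qed.

End TwoSidedFibre.

(** * Homotopy colimits of scalars over a groupoid *)

(* Functors up to coherent isomorphism from J to the 2-category of scalars.
   The compositor is indexed by commutative triangles of J, so that no
   transport along the category laws of J is needed. *)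
Record diagram (J : groupoid) := Diagram {
  dob :> J -> scalar;
  dmap : forall j j', hom j j' -> psmor (dob j) (dob j');
  dunit : forall j, pscell (dmap (idg j)) (psid (dob j));
  dcomp : forall j j' j'' (g : hom j j') (h : hom j' j'') (k : hom j j''),
    g ;; h = k -> pscell (psmcomp (dmap g) (dmap h)) (dmap k);
  dcomp1g : forall j j' (g : hom j j') (e : idg j ;; g = g) x,
    dcomp e x = fmap (dmap g) (dunit j x);
  dcompg1 : forall j j' (g : hom j j') (e : g ;; idg j' = g) x,
    dcomp e x = dunit j' (dmap g x);
  dcompA : forall j0 j1 j2 j3
      (f : hom j0 j1) (g : hom j1 j2) (h : hom j2 j3)
      (fg : hom j0 j2) (gh : hom j1 j3) (k : hom j0 j3)
      (e1 : f ;; g = fg) (e2 : fg ;; h = k)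
      (e3 : g ;; h = gh) (e4 : f ;; gh = k) x,
    fmap (dmap h) (dcomp e1 x) ;; dcomp e2 x
    = dcomp e3 (dmap f x) ;; dcomp e4 x
}.
Arguments dmap {J} d {j j'} g.
Arguments dunit {J} d j.
Arguments dcomp {J} d {j j' j'' g h k} e.

(* Pseudo-natural cocones with vertex Z. *)
Record cocone (J : groupoid) (D : diagram J) (Z : scalar) := Cocone {
  cin :> forall j, psmor (D j) Z;
  ccell : forall j j' (g : hom j j'),
    pscell (cin j) (psmcomp (dmap D g) (cin j'));
  ccell1 : forall j x, ccell (idg j) x ;; fmap (cin j) (dunit D j x) = idg _;
  ccellM : forall j j' j'' (g : hom j j') (h : hom j' j'') (k : hom j j'')
      (e : g ;; h = k) x,
    ccell g x ;; ccell h (dmap D g x) ;; fmap (cin j'') (dcomp D e x)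
    = ccell k x
}.
Arguments ccell {J D Z} c {j j'} g.

Record cocone_iso (J : groupoid) (D : diagram J) (Z : scalar)
    (c c' : cocone D Z) := CoconeIso {
  ciso :> forall j, pscell (c j) (c' j);
  cisoP : forall j j' (g : hom j j') x,
    ccell c g x ;; ciso j' (dmap D g x) = ciso j x ;; ccell c' g x
}.

Program Definition cocone_post (J : groupoid) (D : diagram J) (Z W : scalar)
    (c : cocone D Z) (E : psmor Z W) : cocone D W :=
  @Cocone J D W (fun j => psmcomp (c j) E)
    (fun j j' g => @mk_scell _ _ (psmcomp (c j) E)
       (psmcomp (dmap D g) (psmcomp (c j') E))
       (NatIso (ncomp := fun x => fmap E (ccell c g x)) _)) _ _.
Next Obligation.
by move=> J D Z W c E j j' g x y a /=; rewrite -!fmapM; congr fmap;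
  exact: (nnat (ccell c g) a).
Qed.
Next Obligation.
by move=> J D Z W c E j x /=; rewrite -fmapM ccell1 fmap1.
Qed.
Next Obligation.
by move=> J D Z W c E j j' j'' g h k e x /=; rewrite -!fmapM ccellM.
Qed.

(* Postcomposition with c is an equivalence, for every scalar Z, from the
   groupoid of morphisms C -> Z to the groupoid of cocones with vertex Z:
   it is essentially surjective (first clause) and fully faithful (second). *)
Definition is_hocolim (J : groupoid) (D : diagram J) (C : scalar)
    (c : cocone D C) : Prop :=
  forall Z : scalar,
    (forall d : cocone D Z,
       exists E : psmor C Z, inhabited (cocone_iso (cocone_post c E) d)) /\
    (forall (E E' : psmor C Z)
            (t : cocone_iso (cocone_post c E) (cocone_post c E')),
       exists phi : pscell E E',
         (forall j x, phi (c j x) = t j x) /\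
         (forall phi' : pscell E E',
            (forall j x, phi' (c j x) = t j x) -> forall z, phi' z = phi z)).

(** * Existence of homotopy colimits *)

Section HomotopySum.
Variables (J : groupoid) (D : diagram J).

Definition hs_ob := {j : J & D j}.

Definition hs_hom (u v : hs_ob) : finType :=
  {g : hom (tag u) (tag v) & hom (dmap D g (tagged u)) (tagged v)}.

Definition hs_arr (j j' : J) (x : D j) (y : D j') (g : hom j j')
    (a : hom (dmap D g x) y) :
    hs_hom (Tagged (fun j => ob (D j)) x) (Tagged (fun j => ob (D j)) y) :=
  Tagged (fun g => hom (dmap D g x) y : Type) a.

Definition hs_id (u : hs_ob) : hs_hom u u :=
  Tagged (fun g => hom (dmap D g (tagged u)) (tagged u) : Type)
    (dunit D (tag u) (tagged u)).

Definition hs_cmp (u v w : hs_ob) (a : hs_hom u v) (b : hs_hom v w) :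
    hs_hom u w :=
  Tagged (fun g => hom (dmap D g (tagged u)) (tagged w) : Type)
    (inv (dcomp D (erefl (tag a ;; tag b)) (tagged u))
       ;; fmap (dmap D (tag b)) (tagged a) ;; tagged b).

Definition hs_inv (u v : hs_ob) (a : hs_hom u v) : hs_hom v u :=
  Tagged (fun g => hom (dmap D g (tagged v)) (tagged u) : Type)
    (fmap (dmap D (inv (tag a))) (inv (tagged a))
       ;; dcomp D (cmpgV (tag a)) (tagged u) ;; dunit D (tag u) (tagged u)).

Lemma hs_cmpE (j0 j1 j2 : J) (x0 : D j0) (x1 : D j1) (x2 : D j2)
    (g : hom j0 j1) (a : hom (dmap D g x0) x1)
    (h : hom j1 j2) (b : hom (dmap D h x1) x2)
    (k : hom j0 j2) (e : g ;; h = k) :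
  hs_cmp (hs_arr a) (hs_arr b)
  = hs_arr (inv (dcomp D e x0) ;; fmap (dmap D h) a ;; b).
Proof. by case: k / e. Qed.

Lemma hs_cmp1 u v (a : hs_hom u v) : hs_cmp (hs_id u) a = a.
Proof.
case: u v a => [j x] [j' y] [g a].
rewrite (hs_cmpE _ _ (cmp1g g)); congr existT.
by rewrite dcomp1g cmpVg cmp1g.
Qed.

Lemma hs_cmpg1 u v (a : hs_hom u v) : hs_cmp a (hs_id v) = a.
Proof.
case: u v a => [j x] [j' y] [g a].
rewrite (hs_cmpE _ _ (cmpg1 g)); congr existT.
rewrite dcompg1 -cmpA; have /= -> := nnat (dunit D j') a.
by rewrite cmpKVg.
Qed.

Lemma hs_cmpA u v w z (a : hs_hom u v) (b : hs_hom v w) (c : hs_hom w z) :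
  hs_cmp a (hs_cmp b c) = hs_cmp (hs_cmp a b) c.
Proof.
case: u v w z a b c => [j0 x0] [j1 x1] [j2 x2] [j3 x3] [f a] [g b] [h c].
rewrite (hs_cmpE _ _ (cmpA f g h)) (hs_cmpE _ _ (erefl (f ;; g ;; h))).
congr existT => /=.
have E := dcompA (erefl (f ;; g)) (erefl (f ;; g ;; h)) (erefl (g ;; h))
  (cmpA f g h) x0.
have /= N := nnat (dcomp D (erefl (g ;; h))) a.
rewrite !fmapM fmapV !cmpA; congr (_ ;; _ ;; _).
rewrite -(cmpA _ (fmap _ a)).
have -> : fmap (dmap D (g ;; h)) a ;; inv (dcomp D (erefl (g ;; h)) x1)
  = inv (dcomp D (erefl (g ;; h)) (dmap D f x0))
      ;; fmap (dmap D h) (fmap (dmap D g) a).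
  apply: (@cmpgI _ _ _ _ (dcomp D (erefl (g ;; h)) (dmap D f x0))).
  by rewrite cmpKg cmpA -N cmpgK.
rewrite cmpA; congr (_ ;; _).
by rewrite -!invM -E.
Qed.

Lemma hs_cmpgV u v (a : hs_hom u v) : hs_cmp a (hs_inv a) = hs_id u.
Proof.
case: u v a => [j x] [j' y] [g a].
rewrite (hs_cmpE _ _ (cmpgV g)); congr existT => /=.
by rewrite fmapV -!cmpA cmpKg cmpKVg.
Qed.

Lemma hs_cmpVg u v (a : hs_hom u v) : hs_cmp (hs_inv a) a = hs_id v.
Proof.
rewrite -[X in hs_cmp _ X]hs_cmpg1 -(hs_cmpgV (hs_inv a)).
by rewrite (hs_cmpA a) hs_cmpgV hs_cmp1.
Qed.

Lemma hs_pi0 : exists (T : finType) (r : T -> hs_ob),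
  forall x, exists t, inhabited (hs_hom x (r t)).
Proof.
have [T [r rP]] := pi0_finite J.
have /fin_all_exists[U UP] : forall t : T,
    exists u : {U : finType & U -> D (r t)},
      forall x, exists v, inhabited (hom x (tagged u v)).
  by move=> t; have [U [s sP]] := pi0_finite (D (r t)); exists (existT _ U s).
exists {t : T & tag (U t)},
  (fun v => existT _ (r (tag v)) (tagged (U (tag v)) (tagged v))).
case=> j x; have [t [g]] := rP j; have [v [a]] := UP t (dmap D g x).
exists (existT _ t v); split; exact: hs_arr a.
Qed.

Definition hs_gpd : groupoid :=
  Groupoid hs_cmp1 hs_cmpg1 hs_cmpA hs_cmpgV hs_cmpVg hs_pi0.

(* The Grothendieck construction, with the signs inherited from the D j. *)
Program Definition hosum : scalar :=
  @mk_scalar hs_gpd (fun u => psign (tagged u)) _.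
Next Obligation.
move=> [j x] [j' y] [g a] /=.
by rewrite (psmor_sign (dmap D g) x); exact: psign_const a.
Qed.

Program Definition hs_in_fun (j : J) : functor (D j) hosum :=
  @Functor (D j) hosum (fun x => Tagged (fun j => ob (D j)) x)
    (fun x y a => hs_arr (dunit D j x ;; a)) _ _.
Next Obligation. by move=> j x; rewrite /= cmpg1. Qed.
Next Obligation.
move=> j x y z a b; rewrite /= (hs_cmpE _ _ (cmp1g (idg j))); congr hs_arr.
rewrite dcompg1 (cmpA (inv _ ;; _)) -(cmpA (inv _)) cmpA; congr (_ ;; _).
have /= -> := nnat (dunit D j) (dunit D j x ;; a).
by rewrite cmpKVg.
Qed.

Program Definition hs_in (j : J) : psmor (D j) hosum :=
  @mk_smor (D j) hosum (hs_in_fun j) _.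
Next Obligation. by []. Qed.

Program Definition hs_in_cell (j j' : J) (g : hom j j') :
    pscell (hs_in j) (psmcomp (dmap D g) (hs_in j')) :=
  @mk_scell (D j) hosum (hs_in j) (psmcomp (dmap D g) (hs_in j'))
    (NatIso (ncomp := fun x => hs_arr (idg (dmap D g x))) _).
Next Obligation.
move=> j j' g x y a /=.
rewrite (hs_cmpE _ _ (cmp1g g)) (hs_cmpE _ _ (cmpg1 g)); congr hs_arr.
by rewrite dcomp1g dcompg1 cmpg1 fmapM cmpKVg fmap1 cmpg1 cmpKVg.
Qed.

Program Definition hosum_cocone : cocone D hosum :=
  @Cocone J D hosum hs_in hs_in_cell _ _.
Next Obligation.
move=> j x /=; rewrite (hs_cmpE _ _ (cmp1g (idg j))) /hs_id /=; congr existT.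
by rewrite dcompg1 fmap1 cmpg1 cmpKVg.
Qed.
Next Obligation.
move=> j j' j'' g h k e x /=.
rewrite (hs_cmpE _ _ e) fmap1 !cmpg1 (hs_cmpE _ _ (cmpg1 k)); congr hs_arr.
rewrite dcompg1 cmpA -(cmpA _ _ (dunit D j'' _)).
have /= -> := nnat (dunit D j'') (inv (dcomp D e x)).
by rewrite cmpKVg cmpVg.
Qed.

Lemma hs_arrE (j j' : J) (x : D j) (y : D j') (g : hom j j')
    (a : hom (dmap D g x) y) :
  hs_arr a = hs_cmp (hs_arr (idg (dmap D g x))) (fmap (hs_in j') a).
Proof.
rewrite /= (hs_cmpE _ _ (cmpg1 g)); congr hs_arr.
by rewrite dcompg1 fmap1 cmpg1 cmpKVg.
Qed.

Section Universal.
Variables (Z : scalar) (d : cocone D Z).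

Program Definition hs_desc_fun : functor hosum Z :=
  @Functor hosum Z (fun u => d (tag u) (tagged u))
    (fun u v a => ccell d (tag a) (tagged u) ;; fmap (d (tag v)) (tagged a))
    _ _.
Next Obligation. by move=> [j x] /=; rewrite ccell1. Qed.
Next Obligation.
move=> [j0 x0] [j1 x1] [j2 x2] [g a] [h b] /=.
rewrite -(ccellM d (erefl (g ;; h))) !fmapM fmapV -!cmpA cmpKg.
congr (_ ;; _); rewrite !cmpA; congr (_ ;; _).
by have /= -> := nnat (ccell d h) a.
Qed.

Program Definition hs_desc : psmor hosum Z :=
  @mk_smor hosum Z hs_desc_fun _.
Next Obligation. by move=> [j x] /=; exact: psmor_sign (d j) x. Qed.

Program Definition hs_desc_iso :
    cocone_iso (cocone_post hosum_cocone hs_desc) d :=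
  @CoconeIso J D Z (cocone_post hosum_cocone hs_desc) d
    (fun j => @mk_scell _ _ (psmcomp (hs_in j) hs_desc) (d j)
      (NatIso (ncomp := fun x => idg (d j x)) _)) _.
Next Obligation.
by move=> j x y a /=; rewrite fmapM cmpA ccell1 !cmp1g cmpg1.
Qed.
Next Obligation. by move=> j j' g x /=; rewrite fmap1 !cmpg1 cmp1g. Qed.

End Universal.

Theorem hosum_is_hocolim : is_hocolim hosum_cocone.
Proof.
move=> Z; split=> [d|E E' t].
  by exists (hs_desc d); split; exact: hs_desc_iso.
pose c (u : hosum) : hom (E u) (E' u) :=
    let: existT j x := u return hom (E u) (E' u) in t j x.
have nat_c u v (a : hom u v) : fmap E a ;; c v = c u ;; fmap E' a.
  case: u v a => [j x] [j' y] [g a]; rewrite [existT _ g a]hs_arrE /=.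
  rewrite (fmapM E (y := Tagged (fun j => ob (D j)) (dmap D g x))).
  rewrite (fmapM E' (y := Tagged (fun j => ob (D j)) (dmap D g x))).
  have /= N := nnat (t j') a; have /= C := cisoP t g x.
  by rewrite -cmpA N !cmpA C.
exists (mk_scell (u := E) (v := E') (NatIso nat_c)); split=> // phi' phiP [j x].
exact: phiP.
Qed.

End HomotopySum.

(** * The diagram of two-sided fibres and its canonical cocone *)

Section FibreDiagram.
Variables (I J K : pgroupoid) (X : pspan I J) (Y : pspan J K) (i : I) (k : K).

Definition fib2 (j : J) : scalar := sprod (fibre X i j) (fibre Y j k).

(* The diagonal action: postcomposition with g on X's side, precomposition
   with the inverse of g on Y's side. *)
Definition act_ob (j j' : J) (g : hom j j') (z : fib2 j) : fib2 j' :=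
  (FibOb (fib_src z.1) (fib_tgt z.1 ;; g),
   FibOb (inv g ;; fib_src z.2) (fib_tgt z.2)).

Program Definition act_fun (j j' : J) (g : hom j j') :
    functor (fib2 j) (fib2 j') :=
  @Functor (fib2 j) (fib2 j') (act_ob g)
    (fun z w a => (Sub (val a.1) _, Sub (val a.2) _)) _ _.
Next Obligation.
move=> j j' g z w [[a /= /andP[Ha /eqP Ha']] b] /=.
by rewrite Ha cmpA Ha' eqxx.
Qed.
Next Obligation.
move=> j j' g z w [a [b /= /andP[/eqP Hb Hb']]] /=.
by rewrite Hb' -cmpA Hb eqxx.
Qed.
Next Obligation. by move=> j j' g z; congr pair; apply: val_inj. Qed.
Next Obligation.
by move=> j j' g x y z a b; congr pair; apply: val_inj.
Qed.

Program Definition act (j j' : J) (g : hom j j') : psmor (fib2 j) (fib2 j') :=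
  @mk_smor (fib2 j) (fib2 j') (act_fun g) _.
Next Obligation.
move=> j j' g [x y]; rewrite /psign /= /psign /= /par !fmapM fmapV /=.
by set s := fmap _ g; rewrite !addbA -[in RHS](addbA _ s s) addbb addbF.
Qed.

Program Definition act_unit (j : J) : pscell (act (idg j)) (psid (fib2 j)) :=
  @mk_scell (fib2 j) (fib2 j) (act (idg j)) (psid (fib2 j))
    (NatIso (ncomp := fun z => (Sub (idg _) _, Sub (idg _) _)) _).
Next Obligation.
by move=> j z; rewrite /= !fmap1 !cmpg1 cmp1g !eqxx.
Qed.
Next Obligation.
by move=> j z; rewrite /= !fmap1 inv1 !cmpg1 !cmp1g !eqxx.
Qed.
Next Obligation.
by move=> j z w a; congr pair; apply: val_inj; rewrite /= cmp1g cmpg1.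
Qed.

Program Definition act_comp (j j' j'' : J) (g : hom j j') (h : hom j' j'')
    (gh : hom j j'') (e : g ;; h = gh) :
    pscell (psmcomp (act g) (act h)) (act gh) :=
  @mk_scell (fib2 j) (fib2 j'') (psmcomp (act g) (act h)) (act gh)
    (NatIso (ncomp := fun z => (Sub (idg _) _, Sub (idg _) _)) _).
Next Obligation.
by move=> j j' j'' g h _ <- z; rewrite /= !fmap1 !cmpg1 cmp1g cmpA !eqxx.
Qed.
Next Obligation.
move=> j j' j'' g h _ <- z.
by rewrite /= !fmap1 invM !cmpg1 !cmp1g cmpA !eqxx.
Qed.
Next Obligation.
move=> j j' j'' g h gh e z w a.
by congr pair; apply: val_inj; rewrite /= cmp1g cmpg1.
Qed.

Program Definition fibre_diagram : diagram J :=
  @Diagram J fib2 act act_unit act_comp _ _ _.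
Next Obligation. by move=> j j' g e x; congr pair; apply: val_inj. Qed.
Next Obligation. by move=> j j' g e x; congr pair; apply: val_inj. Qed.
Next Obligation. by move=> *; congr pair; apply: val_inj. Qed.

(* The object ((x, a, b), (y, c, d)) is sent to ((x, b ;; c, y), a, d). *)
Definition can_ob (j : J) (z : fib2 j) : fibre (pscomp X Y) i k :=
  @FibOb I K (pscomp X Y) i k
    (PbOb (fib_tgt z.1 ;; fib_src z.2)) (fib_src z.1) (fib_tgt z.2).

Program Definition can_fun (j : J) :
    functor (fib2 j) (fibre (pscomp X Y) i k) :=
  @Functor (fib2 j) (fibre (pscomp X Y) i k) (@can_ob j)
    (fun z w a => Sub (Sub (val a.1, val a.2) _) _) _ _.
Next Obligation.
move=> j z w [[a /= /andP[_ /eqP Ha]] [b /= /andP[/eqP Hb _]]] /=.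
by rewrite cmpA Ha -cmpA Hb.
Qed.
Next Obligation.
move=> j z w [[a /= /andP[Ha _]] [b /= /andP[_ Hb]]] /=.
by rewrite Ha Hb.
Qed.
Next Obligation. by move=> j z; do 2!apply: val_inj. Qed.
Next Obligation. by move=> j x y z a b; do 2!apply: val_inj. Qed.

Program Definition can_mor (j : J) :
    psmor (fib2 j) (fibre (pscomp X Y) i k) :=
  @mk_smor (fib2 j) (fibre (pscomp X Y) i k) (can_fun j) _.
Next Obligation.
by move=> j [x y]; rewrite /psign /= /psign /= /par !fmapM /= !addbA.
Qed.

Program Definition can_cell (j j' : J) (g : hom j j') :
    pscell (can_mor j) (psmcomp (act g) (can_mor j')) :=
  @mk_scell (fib2 j) (fibre (pscomp X Y) i k) (can_mor j)
    (psmcomp (act g) (can_mor j'))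
    (NatIso (ncomp := fun z => Sub (Sub (idg _, idg _) _) _) _).
Next Obligation.
by move=> j j' g z; rewrite /= !fmap1 cmp1g cmpg1 cmpA cmpgK.
Qed.
Next Obligation.
by move=> j j' g z; rewrite /= !fmap1 cmp1g cmpg1 !eqxx.
Qed.
Next Obligation.
by move=> j j' g z w a; do 2!apply: val_inj; rewrite /= !cmp1g !cmpg1.
Qed.

Program Definition canonical_cocone :
    cocone fibre_diagram (fibre (pscomp X Y) i k) :=
  @Cocone J fibre_diagram _ can_mor can_cell _ _.
Next Obligation. by move=> j x; do 2!apply: val_inj; rewrite /= !cmp1g. Qed.
Next Obligation.
by move=> j j' j'' g h gh e x; do 2!apply: val_inj; rewrite /= !cmp1g.
Qed.

End FibreDiagram.

(* Main.v *)
Require Import Defs.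
From mathcomp Require Import all_boot.
Import Defs. (* [all_boot] shadows [inv] by the inverse of monoid.v *)

(* Homotopy colimits are unique up to equivalence, so it suffices that the
   canonical cocone be one. An object ((x, a, y), s, t) of the fibre of the
   composite is, up to the identity of (x, y), the image of
   ((x, s, 1), (y, a, t)) over j = q_X(x); an arrow (u, v) of the fibre is the
   canonical cell of q_X(u) followed by the image of (u, v). Cocones, and
   isomorphisms between them, are therefore determined by these objects. *)

Set Implicit Arguments.
Unset Strict Implicit.
Unset Printing Implicit Defensive.

#[local] Obligation Tactic := idtac.

Local Open Scope groupoid_scope.

(** * Cocones and uniqueness of homotopy colimits *)

Section Cocones.
Variables (J : groupoid) (D : diagram J).

(** Whisker [s] with [F], then follow with [t]. This shows that the composite of two comparison
    morphisms still respects the cocones. *)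
Program Definition cocone_iso_trans_post (A B C : scalar) (a : cocone D A)
    (b : cocone D B) (c : cocone D C) (E : psmor A B) (F : psmor B C)
    (s : cocone_iso (cocone_post a E) b) (t : cocone_iso (cocone_post b F) c) :
    cocone_iso (cocone_post a (psmcomp E F)) c :=
  @CoconeIso J D C (cocone_post a (psmcomp E F)) c
    (fun j => @mk_scell _ _ (psmcomp (a j) (psmcomp E F)) (c j)
      (NatIso (ncomp := fun x => fmap F (s j x) ;; t j x) _)) _.
Next Obligation.
move=> A B C a b c E F s t j x y u /=.
have /= Hs := nnat (s j) u; have /= Ht := nnat (t j) u.
by rewrite cmpA -fmapM Hs fmapM -!cmpA Ht.
Qed.
Next Obligation.
move=> A B C a b c E F s t j j' g x /=.
have /= Hs := cisoP s g x; have /= Ht := cisoP t g x.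
by rewrite cmpA -fmapM Hs fmapM -!cmpA Ht.
Qed.

Program Definition cocone_iso_post_id (A : scalar) (a b : cocone D A)
    (t : cocone_iso a b) : cocone_iso a (cocone_post b (psid A)) :=
  @CoconeIso J D A a (cocone_post b (psid A))
    (fun j => @mk_scell _ _ (a j) (psmcomp (b j) (psid A))
      (NatIso (ncomp := fun x => t j x) _)) _.
Next Obligation. by move=> A a b t j x y u /=; exact: (nnat (t j) u). Qed.
Next Obligation. by move=> A a b t j j' g x /=; exact: (cisoP t g x). Qed.

(** Full faithfulness lifts the isomorphism of cocones to a 2-cell from [E] to the identity. *)
Lemma hocolim_endo_id (A : scalar) (a : cocone D A) (E : psmor A A) :
  is_hocolim a -> cocone_iso (cocone_post a E) a ->
  inhabited (natiso E (fid A)).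
Proof.
move=> aP t; have [_ ff] := aP A.
by have [phi _] := ff E (psid A) (cocone_iso_post_id t); split; exact: phi.
Qed.

Lemma hocolim_unique (A B : scalar) (a : cocone D A) (b : cocone D B) :
  is_hocolim a -> is_hocolim b ->
  exists E : psmor A B,
    is_psequiv E /\ inhabited (cocone_iso (cocone_post a E) b).
Proof.
move=> aP bP; have [E [s]] := (aP B).1 b; have [F [t]] := (bP A).1 a.
exists E; split=> //; exists F; split.
- exact: (hocolim_endo_id aP (cocone_iso_trans_post s t)).
- exact: (hocolim_endo_id bP (cocone_iso_trans_post t s)).
Qed.

(** A cocone sends an arrow [(g, a)] of the Grothendieck construction to
    [ccell d g x ;; fmap (d j') a], functorially; the hypothesis says that [(l, c)] is the composite
    of [(g, a)] and [(h, b)]. A free triangle [e] avoids transport in [J]. *)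
Lemma ccell_cmp (Z : scalar) (d : cocone D Z) (j j' j'' : J)
    (g : hom j j') (h : hom j' j'') (l : hom j j'') (e : g ;; h = l)
    (x : D j) (y : D j') (z : D j'')
    (a : hom (dmap D g x) y) (b : hom (dmap D h y) z)
    (c : hom (dmap D l x) z) :
  fmap (dmap D h) a ;; b = dcomp D e x ;; c ->
  (ccell d g x ;; fmap (d j') a) ;; (ccell d h y ;; fmap (d j'') b)
  = ccell d l x ;; fmap (d j'') c.
Proof.
move=> abc; rewrite -(ccellM d e).
have /= N := nnat (ccell d h) a.
rewrite -!cmpA (cmpA (fmap _ a)) N -!cmpA; congr (_ ;; (_ ;; _)).
by rewrite -!fmapM; congr fmap.
Qed.

Lemma ccell_cmp_fmap (Z : scalar) (d : cocone D Z) (j j' : J) (g : hom j j')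
    (x : D j) (y z : D j') (a : hom (dmap D g x) y) (b : hom y z) :
  (ccell d g x ;; fmap (d j') a) ;; fmap (d j') b
  = ccell d g x ;; fmap (d j') (a ;; b).
Proof. by rewrite fmapM cmpA. Qed.

Lemma ccell_cmp_ccell (Z : scalar) (d : cocone D Z) (j j' j'' : J)
    (g : hom j j') (h : hom j' j'') (x : D j) (y : D j')
    (a : hom (dmap D g x) y) :
  (ccell d g x ;; fmap (d j') a) ;; ccell d h y
  = ccell d (g ;; h) x
      ;; fmap (d j'') (inv (dcomp D (erefl (g ;; h)) x) ;; fmap (dmap D h) a).
Proof.
rewrite -[ccell d h y]cmpg1 -(fmap1 (d j'')).
apply: (@ccell_cmp _ _ _ _ _ _ _ _ erefl).
by rewrite cmpKg cmpg1.
Qed.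

(** Naturality of [t] along Grothendieck arrows: within a fibre by [nnat], between fibres by
    [cisoP]. *)
Lemma cocone_iso_step (A Z : scalar) (a : cocone D A) (E E' : psmor A Z)
    (t : cocone_iso (cocone_post a E) (cocone_post a E')) (j j' : J)
    (g : hom j j') (x : D j) (y : D j') (u : hom (dmap D g x) y) :
  fmap E (ccell a g x ;; fmap (a j') u) ;; t j' y
  = t j x ;; fmap E' (ccell a g x ;; fmap (a j') u).
Proof.
have /= N := nnat (t j') u; have /= C := cisoP t g x.
by rewrite !fmapM -cmpA N !cmpA C.
Qed.

(** Naturality along [unit] forces the value of [phi]. By [arrP] every arrow of [A] is, up to units,
    the image of a Grothendieck arrow, so [phi] is natural; by [canP] the unit at [a j z] is inverse
    to such an image, so [phi] extends [t]. *)
Lemma cocone_post_ff (A : scalar) (a : cocone D A) (base : A -> J)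
    (lift : forall w, D (base w)) (unit : forall w, hom w (a (base w) (lift w)))
    (arrP : forall w w' (u : hom w w'),
      exists g (v : hom (dmap D g (lift w)) (lift w')),
        unit w ;; (ccell a g (lift w) ;; fmap (a (base w')) v) = u ;; unit w')
    (canP : forall j (z : D j),
      exists g (v : hom (dmap D g (lift (a j z))) z),
        unit (a j z) ;; (ccell a g (lift (a j z)) ;; fmap (a j) v) = idg _)
    (Z : scalar) (E E' : psmor A Z)
    (t : cocone_iso (cocone_post a E) (cocone_post a E')) :
  exists phi : pscell E E',
    (forall j x, phi (a j x) = t j x) /\
    (forall phi' : pscell E E',
       (forall j x, phi' (a j x) = t j x) -> forall w, phi' w = phi w).
Proof.
pose phi w : hom (E w) (E' w) :=
  fmap E (unit w) ;; t (base w) (lift w) ;; inv (fmap E' (unit w)).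
have phi_nat w w' (u : hom w w') : fmap E u ;; phi w' = phi w ;; fmap E' u.
  have [g [v e]] := arrP _ _ u.
  apply: (@cmpIg _ _ _ _ _ _ (fmap E' (unit w'))).
  rewrite -!cmpA cmpVg cmpg1 -fmapM -e !(fmapM _ (unit w)).
  by rewrite cmpKVg cmpA -fmapM -e fmapM -!cmpA cocone_iso_step.
exists (mk_scell (u := E) (v := E') (NatIso phi_nat)).
split=> [j z|phi' phiP w] /=.
  have [g [v e]] := canP j z.
  (* Composed on the right with the images under [E'] of the unit and of its inverse from [canP],
     both sides become [t j z]. *)
  apply: (@cmpIg _ _ _ _ _ _ (fmap E' (unit (a j z)))); rewrite /phi cmpgKV.
  apply: (@cmpIg _ _ _ _ _ _
    (fmap E' (ccell a g (lift (a j z)) ;; fmap (a j) v))).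
  rewrite -!cmpA -cocone_iso_step -(fmapM E') e fmap1 cmpg1.
  by rewrite cmpA -fmapM e fmap1 cmp1g.
by rewrite /phi -phiP; have /= -> := nnat phi' (unit w); rewrite cmpgK.
Qed.

End Cocones.

Arguments ccell_cmp {J D Z} d {j j' j'' g h l} e {x y z a b c} _.

(** * The canonical cocone is a homotopy colimit *)

Lemma square_conj (A : groupoid) (x y z w : A) (a : hom x y) (b : hom x z)
    (c : hom z w) (d : hom y w) :
  a ;; d = b ;; c -> inv a ;; b ;; c = d.
Proof. by move=> e; rewrite -cmpA -e cmpKVg. Qed.

Lemma fib_homP (S T : pgroupoid) (M : pspan S T) (i : S) (j : T)
    (z w : fibre M i j) (u : hom z w) :
  fib_src z ;; fmap (legl M) (val u) = fib_src w /\
  fmap (legr M) (val u) ;; fib_tgt w = fib_tgt z.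
Proof. by case/andP: (valP u) => /eqP-> /eqP->. Qed.

Program Definition fib_pr (S T : pgroupoid) (M : pspan S T) (i : S) (j : T) :
    functor (fibre M i j) M :=
  @Functor (fibre M i j) M (fun z => fib_pt z) (fun _ _ u => val u) _ _.
Next Obligation. by []. Qed.
Next Obligation. by []. Qed.

Lemma pb_homP (A B C : groupoid) (F : functor A C) (G : functor B C)
    (z w : pullback F G) (u : hom z w) :
  fmap F (val u).1 ;; pb_arr w = pb_arr z ;; fmap G (val u).2.
Proof. exact: eqP (valP u). Qed.

(** * Lifting the fibre of the composite to the diagram of fibres *)

Section Canonical.
Variables (I J K : pgroupoid) (X : pspan I J) (Y : pspan J K) (i : I) (k : K).

Local Notation D := (fibre_diagram X Y i k).
Local Notation W := (fibre (pscomp X Y) i k).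
Local Notation can := (canonical_cocone X Y i k).

(** A functor, because descent needs its arrows as indices and its functoriality for the commutative
    triangles in [J]. *)
Definition lift_base : functor W J :=
  fcomp (fib_pr (pscomp X Y) i k) (fcomp (pb_pr1 _ _) (legr X)).

Definition lift_ob (w : W) : D (lift_base w) :=
  (@FibOb I J X i (lift_base w) _ (fib_src w) (idg (lift_base w)),
   @FibOb J K Y (lift_base w) k _ (pb_arr (fib_pt w)) (fib_tgt w)).

Program Definition lift_hom (w w' : W) (u : hom w w') :
    hom (dmap D (fmap lift_base u) (lift_ob w)) (lift_ob w') :=
  (Sub (val (val u)).1 _, Sub (val (val u)).2 _).
Next Obligation.
move=> w w' u; have [H _] := fib_homP u; apply/andP; split; apply/eqP.
  exact: H.
exact: etrans (cmpg1 _) (esym (cmp1g _)).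
Qed.
Next Obligation.
(* The action precomposes the arrow of [w] with the inverse of q_X(u); the pullback square of [u]
   turns this into the arrow of [w']. *)
move=> w w' u; have H := pb_homP (val u); have [_ H'] := fib_homP u.
by apply/andP; split; apply/eqP; [exact: square_conj H | exact: H'].
Qed.

(** The two objects differ only by an identity composed with [pb_arr]. *)
Program Definition lift_unit (w : W) : hom w (can (lift_base w) (lift_ob w)) :=
  Sub (Sub (idg _, idg _) _) _.
Next Obligation. by move=> w; rewrite /= !fmap1 !cmp1g cmpg1. Qed.
Next Obligation. by move=> w; rewrite /= !fmap1 cmpg1 cmp1g !eqxx. Qed.

Lemma can_hom_inj (w w' : W) (u v : hom w w') :
  (val (val u)).1 = (val (val v)).1 -> (val (val u)).2 = (val (val v)).2 ->
  u = v.
Proof.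
move=> e1 e2; do 2!apply: val_inj; move: e1 e2.
by case: (val (val u)) => a b; case: (val (val v)) => a' b' /= -> ->.
Qed.

Lemma lift_unit_nat (w w' : W) (u : hom w w') :
  lift_unit w ;; (ccell can (fmap lift_base u) (lift_ob w)
    ;; fmap (can (lift_base w')) (lift_hom u))
  = u ;; lift_unit w'.
Proof.
by apply: can_hom_inj => /=;
  exact: etrans (cmp1g _) (etrans (cmp1g _) (esym (cmpg1 _))).
Qed.

(** For z = ((x, s, b), (y, c, t)) the lift is ((x, s, 1), (y, b ;; c, t)); acting by b restores b
    on the left and cancels it on the right. *)
Program Definition lift_can (j : J) (z : D j) :
    hom (dmap D (fib_tgt z.1) (lift_ob (can j z))) z :=
  (Sub (idg _) _, Sub (idg _) _).
Next Obligation. by move=> j z; rewrite /= !fmap1 cmpg1 !cmp1g !eqxx. Qed.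
Next Obligation. by move=> j z; rewrite /= !fmap1 cmpg1 cmp1g cmpKVg !eqxx. Qed.

Lemma lift_can_unit (j : J) (z : D j) :
  lift_unit (can j z) ;; (ccell can (fib_tgt z.1) (lift_ob (can j z))
    ;; fmap (can j) (lift_can z)) = idg _.
Proof. by apply: can_hom_inj => /=; exact: etrans (cmp1g _) (cmp1g _). Qed.

Lemma fib2_hom_inj (j : J) (x y : D j) (a b : hom x y) :
  val a.1 = val b.1 -> val a.2 = val b.2 -> a = b.
Proof.
by case: a b => [a1 a2] [b1 b2] e1 e2; congr pair; apply: val_inj.
Qed.

(** * Descent of a cocone to the fibre of the composite *)

Section Descent.
Variables (Z : scalar) (d : cocone D Z).

Definition desc_hom (w w' : W) (u : hom w w') :
    hom (d (lift_base w) (lift_ob w)) (d (lift_base w') (lift_ob w')) :=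
  ccell d (fmap lift_base u) (lift_ob w)
    ;; fmap (d (lift_base w')) (lift_hom u).

Lemma desc_homM (w w' w'' : W) (u : hom w w') (v : hom w' w'') :
  desc_hom (u ;; v) = desc_hom u ;; desc_hom v.
Proof.
apply: esym; apply: (ccell_cmp d (esym (fmapM lift_base u v))).
by apply: fib2_hom_inj => /=; exact: esym (cmp1g _).
Qed.

Program Definition desc_fun : functor W Z :=
  @Functor W Z (fun w => d (lift_base w) (lift_ob w)) desc_hom _ desc_homM.
Next Obligation.
(* An idempotent arrow of a groupoid is an identity. *)
move=> w; apply: (@cmpgI _ _ _ _ (desc_hom (idg w))).
by rewrite -desc_homM !cmpg1.
Qed.

Program Definition desc : psmor W Z := @mk_smor W Z desc_fun _.
Next Obligation.
(* The sign is constant along the unit, and both [can] and [d] preserve it. *)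
move=> w; rewrite (psign_const (lift_unit w)).
rewrite -(psmor_sign (can (lift_base w)) (lift_ob w)).
exact: psmor_sign (d (lift_base w)) (lift_ob w).
Qed.

Definition desc_can_hom (j : J) (z : D j) :
    hom (d (lift_base (can j z)) (lift_ob (can j z))) (d j z) :=
  ccell d (fib_tgt z.1) (lift_ob (can j z)) ;; fmap (d j) (lift_can z).

Lemma desc_can_nat (j : J) (x y : D j) (u : hom x y) :
  desc_hom (fmap (can j) u) ;; desc_can_hom y = desc_can_hom x ;; fmap (d j) u.
Proof.
(* The target condition on the X-part of [u] puts both sides over the same arrow of [J]. *)
have e : fmap lift_base (fmap (can j) u) ;; fib_tgt y.1 = fib_tgt x.1.
  exact: (fib_homP u.1).2.
apply: etrans (esym (ccell_cmp_fmap d _ _)); apply: (ccell_cmp d e).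
by apply: fib2_hom_inj => /=;
  exact: etrans (cmpg1 _) (esym (etrans (cmp1g _) (cmp1g _))).
Qed.

Lemma desc_can_ccell (j j' : J) (g : hom j j') (x : D j) :
  desc_hom (ccell can g x) ;; desc_can_hom (dmap D g x)
  = desc_can_hom x ;; ccell d g x.
Proof.
(* The canonical cell has identity components, so it lies over an identity of [J]. *)
have e : fmap lift_base (ccell can g x) ;; (fib_tgt x.1 ;; g)
    = fib_tgt x.1 ;; g.
  exact: etrans (congr1 (fun h => h ;; _) (fmap1 (legr X) _)) (cmp1g _).
apply: etrans (esym (ccell_cmp_ccell d _ _)).
apply: (ccell_cmp d e).
by apply: fib2_hom_inj => /=;
  exact: etrans (cmp1g _) (esym (etrans (cmp1g _) (cmpVg _))).
Qed.

Program Definition desc_iso : cocone_iso (cocone_post can desc) d :=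
  @CoconeIso J D Z (cocone_post can desc) d
    (fun j => @mk_scell _ _ (psmcomp (can j) desc) (d j)
      (NatIso (ncomp := @desc_can_hom j) (@desc_can_nat j))) desc_can_ccell.

End Descent.

Theorem canonical_is_hocolim : is_hocolim can.
Proof.
move=> Z; split=> [d|E E' t].
  by exists (desc d); split; exact: desc_iso.
apply: (@cocone_post_ff _ _ _ _ lift_base lift_ob lift_unit _ _ _ _ _ t).
- move=> w w' u; exists (fmap lift_base u), (lift_hom u).
  exact: lift_unit_nat.
- by move=> j z; exists (fib_tgt z.1), (lift_can z); exact: lift_can_unit.
Qed.

End Canonical.

Theorem corollary2p12p4 (I J K : pgroupoid) (X : pspan I J) (Y : pspan J K)
    (i : I) (k : K) (S : scalar) (c : cocone (fibre_diagram X Y i k) S)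
    (hS : is_hocolim c) :
  exists E : psmor (fibre (pscomp X Y) i k) S,
    is_psequiv E /\
    inhabited (cocone_iso (cocone_post (canonical_cocone X Y i k) E) c).
Proof. exact: hocolim_unique (@canonical_is_hocolim I J K X Y i k) hS. Qed.
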